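(* Let $\{S_\imath:\imath\in\mathcal{I}\}$ be an infinite collection of right cancellative semigroups, each having an identity element, with a given net $\mathcal{F}_\imath$ in $\mathcal{P}_f(S_\imath)$ for each $\imath\in\mathcal{I}$. Let $\mathcal{F}$ be the product net determined by $\{\mathcal{F}_\imath:\imath\in\mathcal{I}\}$. Let $\imath_0\in\mathcal{I}$ and let $\pi_{\imath_0}:\prod_{\imath\in\mathcal{I}}S_\imath\to S_{\imath_0}$ be the projection map onto the $\imath_0$-th component. Then $\pi_{\imath_0}$ maps the $D$-sets (with respect to $\mathcal{F}$) of $\prod_{\imath\in\mathcal{I}}S_\imath$ onto the $D$-sets (with respect to $\mathcal{F}_{\imath_0}$) of $S_{\imath_0}$; that is, $\{\pi_{\imath_0}(A): A\text{ is a }D\text{-set with respect to }\mathcal{F}\}=\{B: B\text{ is a }D\text{-set with respect to }\mathcal{F}_{\imath_0}\}$.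
   Context: Semigroups are nonempty and discrete; $\mathcal{P}_f(X)$ is the set of finite nonempty subsets of $X$; $\prod_{\imath}S_\imath$ is the Cartesian (direct) product semigroup. $\beta S$ is the space of ultrafilters on $S$ (Stone–Čech compactification), with basic open sets $\overline{A}=\{p\in\beta S: A\in p\}$ for $A\subseteq S$, and semigroup operation $pq=\{A\subseteq S:\{s\in S: s^{-1}A\in q\}\in p\}$, where $s^{-1}A=\{t\in S: st\in A\}$. For a net $\mathcal{F}=\langle F_i\rangle_{i\in I}$ in $\mathcal{P}_f(S)$ ($I$ a directed set) and $A\subseteq S$, the upper Banach density of $A$ with respect to $\mathcal{F}$ is $$d_{\mathcal{F}}^*(A)=\sup\{\alpha: (\forall i_0\in I)(\exists i\geq i_0)(\exists s\in S\cup\{1\})(|A\cap(F_i\cdot s)|\geq\alpha|F_i|)\},$$ where $F_i\cdot 1$ means $F_i$. Put $D_{\mathcal{F}}^*=\{p\in\beta S:(\forall A\in p)(d_{\mathcal{F}}^*(A)>0)\}$. A subset $A\subseteq S$ is a $D$-set with respect to $\mathcal{F}$ if $A\in p$ for some idempotent $p$ ($pp=p$) of $\beta S$ with $p\in D_{\mathcal{F}}^*$. Product net of a family: let $\mathcal{F}_\imath=\langle F_{\imath,j}\rangle_{j\in J_\imath}$ be a net in $\mathcal{P}_f(S_\imath)$ for $\imath\in\mathcal{I}$, each $S_\imath$ having an identity $1$. Let $J_\imath'=J_\imath\cup\{1\}$, where $1$ is a point not in $J_\imath$, put $F_{\imath,1}=\{1\}$ (the identity), and specify $1\leq j$ for all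 $j\in J_\imath$. Let $\mathfrak{J}=\{\vec{j}\in\prod_{\imath\in\mathcal{I}}J_\imath':\{\imath\in\mathcal{I}: j(\imath)\neq 1\}\text{ is finite}\}$, ordered by $\vec{j}\leq\vec{k}$ iff $j(\imath)\leq k(\imath)$ for every $\imath\in\mathcal{I}$. The product net determined by $\{\mathcal{F}_\imath:\imath\in\mathcal{I}\}$ is $\mathcal{F}=\langle\prod_{\imath\in\mathcal{I}}F_{\imath,j(\imath)}\rangle_{\vec{j}\in\mathfrak{J}}$. *)

(* Defs.v *)
From HB Require Import structures.
From mathcomp Require Import all_boot all_order all_algebra finmap.
From mathcomp Require Import mathcomp_extra boolp classical_sets functions.
From mathcomp Require Import cardinality filter reals.

Set Implicit Arguments.
Unset Strict Implicit.
Unset Printing Implicit Defensive.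

Import Order.TTheory GRing.Theory Num.Theory.

Local Open Scope classical_set_scope.
Local Open Scope ring_scope.

(* The order of a directed set is not required to be antisymmetric. *)
Record directedSet := DirectedSet {
  ds_sort :> Type;
  ds_le : ds_sort -> ds_sort -> Prop;
  ds_inhabited : inhabited ds_sort;
  ds_le_refl : forall j, ds_le j j;
  ds_le_trans : forall k j l, ds_le j k -> ds_le k l -> ds_le j l;
  ds_le_ub : forall j k, exists l, ds_le j l /\ ds_le k l
}.

(* The finite nonempty subsets of X. *)
Definition Pf (X : Type) : set (set X) :=
  [set A | finite_set A /\ A !=set0].

Definition is_right_cancellative (S : semigroupType) : Prop :=
  forall x y z : S, (x * z = y * z)%g -> x = y.

(* The product of ultrafilters p and q in the convention of Hindman-Strauss:
   s^-1 A = { t | s t \in A }, and p sits on the outside. *)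
Definition umul (S : semigroupType) (p q : set_system S) : set_system S :=
  [set A | p [set s | q [set t | A (s * t)%g]]].

Section Density.
Variables (R : realType) (S : semigroupType) (J : directedSet).
Implicit Types (F : J -> set S) (A B : set S).

(* [None] is the adjoined point 1 of S u {1}, for which B . 1 = B. *)
Definition rtranslate B (s : option S) : set S :=
  if s is Some s then [set (b * s)%g | b in B] else B.

(* For F with values in [Pf S] the set below contains 0 and is bounded above
   by 1, so that [sup] is a genuine supremum. *)
Definition upper_banach_density F A : R :=
  sup [set alpha : R | forall j0 : J, exists j : J, ds_le j0 j /\
    exists s : option S,
      alpha * (#|` fset_set (F j)|)%fset%:R
        <= (#|` fset_set (A `&` rtranslate (F j) s)|)%fset%:R].

Definition Dstar F : set (set_system S) :=
  [set p | UltraFilter p /\ forall A, p A -> 0 < upper_banach_density F A].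

Definition Dset F : set (set S) :=
  [set A | exists p : set_system S, [/\ Dstar F p, umul p p = p & p A]].

End Density.

(* [dirprod S] is an alias of [forall i, S i] carrying the pointwise monoid
   structure. *)
Definition dirprod (I : Type) (S : I -> monoidType) : Type := forall i, S i.

Section DirectProduct.
Variables (I : Type) (S : I -> monoidType).

HB.instance Definition _ := Choice.copy (dirprod S) (forall i, S i).

Definition dirprod_mul (x y : dirprod S) : dirprod S :=
  fun i => (x i * y i)%g.

Definition dirprod_one : dirprod S := fun i => 1%g.

Fact dirprod_mulA : associative dirprod_mul.
Proof. by move=> x y z; apply: functional_extensionality_dep => i; exact: mulgA. Qed.

Fact dirprod_mul1g : left_id dirprod_one dirprod_mul.
Proof. by move=> x; apply: functional_extensionality_dep => i; exact: mul1g. Qed.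

Fact dirprod_mulg1 : right_id dirprod_one dirprod_mul.
Proof. by move=> x; apply: functional_extensionality_dep => i; exact: mulg1. Qed.

HB.instance Definition _ := isMonoid.Build (dirprod S)
  dirprod_mulA dirprod_mul1g dirprod_mulg1.

End DirectProduct.

(* J' = J u {1}, the new point 1 being [None]; it lies strictly below J. *)
Definition adjoin_le (J : directedSet) (j k : option J) : Prop :=
  match j, k with
  | None, _ => True
  | Some _, None => False
  | Some j, Some k => ds_le j k
  end.

Section ProductIndex.
Variables (I : Type) (J : I -> directedSet).

Definition finite_support (j : forall i, option (J i)) : Prop :=
  finite_set [set i | j i <> None].

Definition prod_index_sort : Type :=
  {j : forall i, option (J i) | finite_support j}.

Definition prod_index_le (j k : prod_index_sort) : Prop :=
  forall i, adjoin_le (sval j i) (sval k i).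

Fact prod_index_inhabited : inhabited prod_index_sort.
Proof.
constructor; exists (fun=> None).
by rewrite /finite_support (_ : [set _ | _] = set0) // -subset0 => i.
Qed.

Fact prod_index_le_refl j : prod_index_le j j.
Proof.
by move=> i; case: (sval j i) => //= a; exact: ds_le_refl.
Qed.

Fact prod_index_le_trans k j l :
  prod_index_le j k -> prod_index_le k l -> prod_index_le j l.
Proof.
move=> jk kl i; move: (jk i) (kl i).
case: (sval j i) => [a|//]; case: (sval k i) => [b|//]; case: (sval l i) => //=.
by move=> c; exact: ds_le_trans.
Qed.

Fact prod_index_le_ub j k :
  exists l, prod_index_le j l /\ prod_index_le k l.
Proof.
have ub i : {l : option (J i) | [/\ adjoin_le (sval j i) l,
    adjoin_le (sval k i) l &
    l <> None -> sval j i <> None \/ sval k i <> None]}.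
  apply: cid; case: (sval j i) => [a|]; case: (sval k i) => [b|].
  - have [c [ac bc]] := ds_le_ub a b.
    by exists (Some c); split => // _; left.
  - by exists (Some a); split => //=; [exact: ds_le_refl|left].
  - by exists (Some b); split => //=; [exact: ds_le_refl|right].
  - by exists None.
have fin_l : finite_support (fun i => sval (ub i)).
  apply: (@sub_finite_set _ _
    ([set i | sval j i <> None] `|` [set i | sval k i <> None])).
    by move=> i /=; case: (svalP (ub i)) => _ _; exact.
  by rewrite finite_setU; split; [exact: svalP j|exact: svalP k].
exists (exist _ _ fin_l); split=> i /=;
  by case: (svalP (ub i)).
Qed.

Definition prod_index : directedSet :=
  DirectedSet prod_index_inhabited prod_index_le_refl
    prod_index_le_trans prod_index_le_ub.

End ProductIndex.

(* F_1 = {1} at the adjoined index. *)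
Definition adjoin_net (J : directedSet) (S : monoidType) (F : J -> set S)
    (j : option J) : set S :=
  if j is Some j then F j else [set 1%g].

Definition prod_net (I : Type) (J : I -> directedSet) (S : I -> monoidType)
    (F : forall i, J i -> set (S i)) (j : prod_index J) : set (dirprod S) :=
  [set x | forall i, adjoin_net (F i) (sval j i) (x i)].

(* Main.v *)
(* Pushing an idempotent of D*_F forward along the projection gives an
   idempotent of D*_{F_i0}, because a cylinder over B meets a translate of a
   product of finite sets in a product, so that B and its cylinder have
   positive density simultaneously. Conversely, for an idempotent q in
   D*_{F_i0}, the p in D*_F that project to q form a nonempty compact
   subsemigroup of the ultrafilters (D*_F is a right ideal by right
   cancellation), which contains an idempotent by the Ellis-Numakura theorem.
   Closed sets of ultrafilters are represented by the filters of sets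
   common to all their members. *)

Require Import Defs.
From mathcomp Require Import all_boot all_order all_algebra finmap.
From mathcomp Require Import mathcomp_extra boolp classical_sets functions.
From mathcomp Require Import cardinality filter reals.

Import Order.TTheory GRing.Theory Num.Theory.

Local Open Scope classical_set_scope.

(** * Ultrafilters and the Ellis-Numakura theorem *)

Section Ultrafilters.
Set Implicit Arguments.
Unset Strict Implicit.
Variable T : Type.
Implicit Types (F G p : set_system T) (A : set T).

Lemma ultra_dichotomy F : ProperFilter F ->
  (forall A, F A \/ F (~` A)) -> UltraFilter F.
Proof.
move=> FF dich; split=> // G GF FG; apply/seteqP; split=> // A GA.
case: (dich A) => // /FG GnA.
by have [x []] := filter_ex (filterI GA GnA).
Qed.

Lemma ultra_eq F G : UltraFilter F -> ProperFilter G -> F `<=` G -> G = F.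
Proof. by move=> uF pG; exact: max_filter. Qed.

Lemma ultra_notC F A : UltraFilter F -> F A -> ~ F (~` A).
Proof. by move=> uF FA FnA; have [x []] := filter_ex (filterI FA FnA). Qed.

Lemma filter_ultra G A : Filter G ->
  (forall p, UltraFilter p -> G `<=` p -> p A) -> G A.
Proof.
move=> GF ultraA; apply: contrapT => nGA.
have GnA : ProperFilter (within (~` A) G).
  split; last exact: within_filter.
  rewrite /within /= => G0; apply: nGA; apply: filterS G0 => x /= nAx.
  exact: contrapT.
have [p [up sub]] := ultraFilterLemma GnA.
have Gp : G `<=` p.
  by move=> X GX; apply: sub; apply: filterS GX => x Xx _.
apply: (ultra_notC up (ultraA p up Gp)).
by apply: sub; rewrite /within /=; exact: filterE.
Qed.

End Ultrafilters.

Lemma ultra_fmap (T U : Type) (f : T -> U) (p : set_system T) :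
  UltraFilter p -> UltraFilter (fmap f p).
Proof.
move=> up; apply: ultra_dichotomy.
by move=> A; exact: in_ultra_setVsetC (f @^-1` A) up.
Qed.

(** * Idempotents in closed semigroups of ultrafilters *)

Section EllisNumakura.
Set Implicit Arguments.
Unset Strict Implicit.
Variable S : semigroupType.
Implicit Types (F G p q r u : set_system S) (A B : set S).

Lemma umulA p q r : umul p (umul q r) = umul (umul p q) r.
Proof.
apply: funext => A; rewrite /umul /mkset.
congr (p _); apply: funext => s; congr (q _); apply: funext => t.
by congr (r _); apply: funext => w; rewrite mulgA.
Qed.

Lemma umul_mono p q r : p `<=` q -> umul p r `<=` umul q r.
Proof. by move=> pq A; exact: pq. Qed.

Lemma umul_proper p q : ProperFilter p -> ProperFilter q ->
  ProperFilter (umul p q).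
Proof.
move=> pF qF; split.
  rewrite /umul /= => h; have [s qs] := filter_ex h.
  by have [t] := filter_ex qs.
split.
- by rewrite /umul /=; apply: filterE => s; exact: filterE.
- move=> A B; rewrite /umul /= => pA pB.
  by apply: filterS2 pA pB => s; exact: filterI.
- move=> A B AB; rewrite /umul /=; apply: filterS => s /=.
  by apply: filterS => t; exact: AB.
Qed.

Lemma umul_ultra p q : UltraFilter p -> UltraFilter q ->
  UltraFilter (umul p q).
Proof.
move=> up uq; apply: ultra_dichotomy; first exact: umul_proper.
move=> A; case: (in_ultra_setVsetC [set s | q [set t | A (s * t)%g]] up).
  by left.
move=> pA; right; rewrite /umul /=; apply: filterS pA => s /= nqs.
by case: (in_ultra_setVsetC [set t | A (s * t)%g] uq).
Qed.

(* The ultrafilters r containing the filter [umul_quotient G p u] are those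
   with G `<=` r and umul r p = u. *)
Definition umul_quotient G p u : set_system S :=
  [set X | exists2 A, u A & G [set s | p [set t | A (s * t)%g] -> X s]].

Lemma sub_umul_quotient G p u : ProperFilter u -> Filter G ->
  G `<=` umul_quotient G p u.
Proof.
move=> uF GF X GX; exists setT; first exact: filterT.
by apply: filterS GX => s Xs _.
Qed.

(** If the empty set belonged to the quotient, some [A] in [u] would have its complement in
    [umul G p], hence in [u]. *)
Lemma umul_quotient_proper G p u : ProperFilter G -> UltraFilter p ->
  UltraFilter u -> umul G p `<=` u -> ProperFilter (umul_quotient G p u).
Proof.
move=> GF up uu Gpu; split.
  move=> [A uA GA]; apply: (ultra_notC uu uA); apply: Gpu.
  rewrite /umul /=; apply: filterS GA => s /= npA.
  by case: (in_ultra_setVsetC [set t | A (s * t)%g] up).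
split.
- by exists setT; [exact: filterT|exact: filterE].
- move=> X Y [A uA GA] [B uB GB]; exists (A `&` B); first exact: filterI.
  apply: filterS2 GA GB => s /= AX BY pAB; split.
    by apply: AX; apply: filterS pAB => t [].
  by apply: BY; apply: filterS pAB => t [].
- move=> X Y XY [A uA GA]; exists A => //.
  by apply: filterS GA => s AX /AX /XY.
Qed.

(** For [A] in [u], the set of all s with s^-1 A in [p] lies in the quotient, so [u] is contained in
    the proper filter [umul r p]; ultrafilters are maximal. *)
Lemma umul_quotientK G p u r : ProperFilter r -> UltraFilter p ->
  UltraFilter u -> Filter G -> umul_quotient G p u `<=` r -> umul r p = u.
Proof.
move=> rF up uu GF sub; apply: ultra_eq.
  exact: umul_proper.
by move=> A uA; apply: sub; exists A => //; apply: filterE => s.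
Qed.

(* The closed set of ultrafilters containing G is a nonempty subsemigroup;
   minimal such sets correspond to maximal such filters. *)
Definition semigroup_filter G := ProperFilter G /\
  forall p q, UltraFilter p -> UltraFilter q -> G `<=` p -> G `<=` q ->
    G `<=` umul p q.

(** Zorn's lemma is applied to the [X] for which [G0] together with [X] is a semigroup filter, which
    keeps every candidate above [G0]. *)
Lemma maximal_semigroup_filter G0 : semigroup_filter G0 ->
  exists G, [/\ semigroup_filter G, G0 `<=` G &
    forall H, semigroup_filter H -> G `<=` H -> H = G].
Proof.
move=> sG0.
pose P := [set X : set_system S | semigroup_filter (G0 `|` X)].
have chainP (C : set (set_system S)) : C `<=` P -> total_on C subset ->
    P (\bigcup_(X in C) X).
  move=> CP Ctot; rewrite /P /=; set U := G0 `|` _.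
  (* Allowing [H = set0] covers the empty chain, for which [U] is [G0]. *)
  have GU H : (H = set0 \/ C H) -> (G0 `|` H) `<=` U.
    move=> [->|CH] A [GA|HA]; [by left|by []|by left|].
    by right; exists H.
  have sH H : (H = set0 \/ C H) -> semigroup_filter (G0 `|` H).
    by move=> [->|/CP//]; rewrite setU0.
  have U1 A : U A -> exists H, (H = set0 \/ C H) /\ (G0 `|` H) A.
    move=> [GA|[X CX XA]].
      by exists set0; split; left.
    by exists X; split; right.
  have U2 A B : U A -> U B -> exists H,
      [/\ H = set0 \/ C H, (G0 `|` H) A & (G0 `|` H) B].
    move=> /U1 [X [CX XA]] /U1 [Y [CY YB]].
    have [XY|YX] : X `<=` Y \/ Y `<=` X.
      case: CX => [->|CX]; first by left.
      by case: CY => [->|CY]; [right|exact: Ctot].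
    - by exists Y; split => //; case: XA => [|/XY]; [left|right].
    - by exists X; split => //; case: YB => [|/YX]; [left|right].
  split.
    split.
      move=> /U1 [H [CH H0]]; have [HF _] := sH _ CH.
      by have [] := filter_ex H0.
    split.
    - by left; case: sG0 => ? _; exact: filterT.
    - move=> A B UA UB; have [H [CH HA HB]] := U2 _ _ UA UB.
      have [HF _] := sH _ CH; apply: (GU _ CH); exact: filterI.
    - move=> A B AB /U1 [H [CH HA]]; have [HF _] := sH _ CH.
      by apply: (GU _ CH); apply: filterS HA.
  move=> p q up uq Up Uq A /U1 [H [CH HA]]; have [_ Hpq] := sH _ CH.
  by apply: (Hpq p q up uq _ _ A HA) => X /(GU _ CH) => [/Up|/Uq].
have [X [PX maxX]] := Zorn_bigcup chainP.
exists (G0 `|` X); split=> //.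
move=> H sHH GH; apply/seteqP; split => //.
have [->|neq] := pselect (H = X); first exact: subsetUr.
exfalso; apply: (maxX H).
  rewrite properEneq; split; last by move=> A XA; apply: GH; right.
  by apply/eqP => e; apply: neq.
rewrite /P /= (_ : G0 `|` H = H) //; apply/seteqP; split; last exact: subsetUr.
by move=> A [GA|//]; apply: GH; left.
Qed.

(** Let L be the minimal closed semigroup given by a maximal [G], and p in L. First Lp = L; hence
    the r in L with rp = p form a nonempty closed semigroup, which by minimality is L and so
    contains p. *)
Lemma ellis_numakura G0 : semigroup_filter G0 ->
  exists p, [/\ UltraFilter p, G0 `<=` p & umul p p = p].
Proof.
move=> /maximal_semigroup_filter [G [[GF Gmul] G0G maxG]].
have [p [up Gp]] := ultraFilterLemma GF.
have pF := @ultra_proper _ _ up.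
(* This is the inclusion of Lp in L, tested on the ultrafilters above [G]. *)
have GGp : G `<=` umul G p.
  move=> A GA; rewrite /umul /=; apply: filter_ultra => u uu Gu.
  exact: (Gmul u p uu up Gu Gp).
have quot u : UltraFilter u -> umul G p `<=` u ->
    exists r, [/\ UltraFilter r, G `<=` r & umul r p = u].
  move=> uu Gpu; have HF := umul_quotient_proper GF up uu Gpu.
  have [r [ur Hr]] := ultraFilterLemma HF.
  exists r; split => //.
    by apply: subset_trans Hr; apply: sub_umul_quotient.
  exact: umul_quotientK Hr.
(* Lp is a semigroup because (rp)(r'p) = (r(pr'))p with r(pr') in L, so maximality of [G]
   applies. *)
have GpG : umul G p = G.
  apply: (maxG) => //; split; first exact: umul_proper.
  move=> u v uu uv Gu Gv.
  have [r [ur Gr <-]] := quot u uu Gu.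
  have Gv' := subset_trans GGp Gv.
  have [r' [ur' Gr' e']] := quot v uv Gv.
  rewrite -e' umulA; apply: umul_mono; rewrite -umulA.
  apply: (Gmul) => //; first exact: umul_ultra.
  exact: Gmul.
have Gpp : umul G p `<=` p by rewrite GpG.
have HF := umul_quotient_proper GF up up Gpp.
have GH : G `<=` umul_quotient G p p by apply: sub_umul_quotient.
(* Maximality again: ap = p and bp = p give (ab)p = p, so the quotient is a semigroup filter. *)
have HG : umul_quotient G p p = G.
  apply: maxG => //; split=> // a b ua ub Ha Hb X [A pA GX].
  have ap : umul a p = p by exact: umul_quotientK Ha.
  have bp : umul b p = p by exact: umul_quotientK Hb.
  have uab := umul_ultra ua ub.
  have abp : umul (umul a b) p = p by rewrite -umulA bp.
  have abG : umul a b [set s | p [set t | A (s * t)%g] -> X s].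
    by apply: Gmul GX => //; exact: subset_trans GH _.
  have abA : umul a b [set s | p [set t | A (s * t)%g]].
    by rewrite -abp in pA.
  by apply: filterS2 abG abA => s; apply.
exists p; split=> //; first exact: subset_trans Gp.
by apply: (@umul_quotientK G) => //; rewrite HG.
Qed.

End EllisNumakura.

(** * Upper Banach density *)

Local Notation card A := (#|` fset_set A|)%fset.

(** * Cardinalities of finite sets *)

Section FiniteCardinals.
Set Implicit Arguments.
Unset Strict Implicit.
Variables T U : choiceType.
Implicit Types A B : set T.

Lemma sub_card A B : finite_set B -> A `<=` B -> (card A <= card B)%N.
Proof.
move=> finB AB; apply: fsubset_leq_card.
by rewrite -fset_set_sub //; exact: sub_finite_set finB.
Qed.

Lemma card_image_le (f : T -> U) A :
  finite_set A -> (card [set f x | x in A] <= card A)%N.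
Proof. by move=> finA; rewrite fset_set_image // leq_imfset_card. Qed.

Lemma card_image_inj (f : T -> U) A : finite_set A ->
  {in A &, injective f} -> card [set f x | x in A] = card A.
Proof.
move=> finA finj; rewrite fset_set_image // card_in_imfset //= => x y.
by rewrite !in_fset_set //; exact: finj.
Qed.

Lemma card_setX A (B : set U) : finite_set A -> finite_set B ->
  card (A `*` B) = (card A * card B)%N.
Proof.
move=> finA finB; rewrite fset_setX //.
set X := fset_set A; set Y := fset_set B.
suff : perm_eq (X `*` Y)%fset [seq (x, y) | x <- X, y <- Y].
  by move=> /perm_size ->; rewrite size_allpairs.
apply: uniq_perm; first exact: fset_uniq.
  by apply: allpairs_uniq => // -[? ?] [? ?] _ _.
move=> [x y]; rewrite in_fsetM; apply/idP/allpairsP => [/andP[? ?]|].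
  by exists (x, y).
by move=> [[x' y'] [? ? [-> ->]]]; apply/andP.
Qed.

Lemma card_setU_le A B : finite_set A -> finite_set B ->
  (card (A `|` B) <= card A + card B)%N.
Proof. by move=> finA finB; rewrite fset_setU // cardfsU leq_subr. Qed.

Lemma card_fset_set_gt0 A : finite_set A -> A !=set0 -> (0 < card A)%N.
Proof.
move=> finA [x Ax]; rewrite cardfs_gt0; apply/fset0Pn; exists x.
by rewrite in_fset_set // inE.
Qed.

End FiniteCardinals.

(** * Sets of positive upper Banach density *)

Section Density.
Set Implicit Arguments.
Unset Strict Implicit.
Local Open Scope ring_scope.
Variables (R : realType) (S : semigroupType) (J : directedSet).
Variable F : J -> set S.
Hypothesis F_Pf : forall j, Pf (F j).
Implicit Types (A B : set S) (alpha : R).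

(** Membership in the set whose supremum is [upper_banach_density]. *)
Definition cofinally_dense A alpha := forall j0 : J, exists j : J,
  ds_le j0 j /\ exists s : option S,
    alpha * (card (F j))%:R <= (card (A `&` rtranslate (F j) s))%:R.

Lemma finite_rtranslate A s : finite_set A -> finite_set (rtranslate A s).
Proof. by case: s => //= s; exact: finite_image. Qed.

Lemma card_rtranslate_le A s :
  finite_set A -> (card (rtranslate A s) <= card A)%N.
Proof. by case: s => //= s; exact: card_image_le. Qed.

Let card_F_gt0 j : 0 < (card (F j))%:R :> R.
Proof. by have [? ?] := F_Pf j; rewrite ltr0n card_fset_set_gt0. Qed.

Lemma cofinally_dense_ub A : ubound (cofinally_dense A) 1.
Proof.
move=> alpha h; have [j0] := ds_inhabited J.
have [j [_ [s hs]]] := h j0; have [finF _] := F_Pf j.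
rewrite -(ler_pM2r (card_F_gt0 j)) mul1r (le_trans hs) // ler_nat.
apply: leq_trans (card_rtranslate_le s finF).
by apply: sub_card; [exact: finite_rtranslate|move=> x []].
Qed.

Lemma cofinally_dense0 A : cofinally_dense A 0.
Proof.
move=> j0; exists j0; split; first exact: ds_le_refl.
by exists None; rewrite mul0r.
Qed.

(** The member 0 and the upper bound 1 make the supremum genuine, so it is positive exactly when
    some member is. *)
Lemma density_gt0P A : 0 < upper_banach_density R F A <->
  exists2 alpha, 0 < alpha & cofinally_dense A alpha.
Proof.
split.
  move=> /sup_gt [|alpha]; first by exists 0; exact: cofinally_dense0.
  by exists alpha.
move=> [alpha a0 Aa]; apply: lt_le_trans a0 _; apply: ub_le_sup Aa.
by exists 1; exact: cofinally_dense_ub.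
Qed.

Lemma density_sub A B : A `<=` B ->
  0 < upper_banach_density R F A -> 0 < upper_banach_density R F B.
Proof.
move=> AB /density_gt0P [a a0 Aa]; apply/density_gt0P; exists a => // j0.
have [j [lej [s hs]]] := Aa j0; exists j; split=> //; exists s.
have [finF _] := F_Pf j.
rewrite (le_trans hs) // ler_nat; apply: sub_card; last exact: setSI.
by apply: finite_setIr; exact: finite_rtranslate.
Qed.

Lemma density_set0 : ~ 0 < upper_banach_density R F set0.
Proof.
move=> /density_gt0P [a a0 h]; have [j0] := ds_inhabited J.
have [j [_ [s]]] := h j0; rewrite set0I fset_set0 cardfs0 leNgt.
by rewrite mulr_gt0.
Qed.

(** If neither part had positive density, each would eventually fill less than a share [a / 2] of
    every translate; an index beyond both thresholds contradicts the share [a] of the union. *)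
Lemma density_setU A B : 0 < upper_banach_density R F (A `|` B) ->
  0 < upper_banach_density R F A \/ 0 < upper_banach_density R F B.
Proof.
move=> /density_gt0P [a a0 ABa]; apply: contrapT => /not_orP [nA nB].
have a2 : 0 < a / 2 by rewrite divr_gt0.
have nd C : ~ 0 < upper_banach_density R F C ->
    exists j0, forall j, ds_le j0 j -> forall s,
      (card (C `&` rtranslate (F j) s))%:R < a / 2 * (card (F j))%:R.
  move=> nC; apply: contrapT => /forallNP h; apply: nC.
  apply/density_gt0P; exists (a / 2) => // j0.
  have /existsNP [j /not_implyP [lej /existsNP [s /negP]]] := h j0.
  by rewrite -leNgt => hs; exists j; split => //; exists s.
have [jA hA] := nd _ nA; have [jB hB] := nd _ nB.
have [l [Al Bl]] := ds_le_ub jA jB.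
have [j [lj [s hs]]] := ABa l; have [finF _] := F_Pf j.
have finFs := finite_rtranslate s finF.
have := ltrD (hA j (ds_le_trans Al lj) s) (hB j (ds_le_trans Bl lj) s).
rewrite -mulrDl -splitr -natrD ltNge => /negP; apply.
rewrite (le_trans hs) // ler_nat setIUl.
by apply: card_setU_le; exact: finite_setIr.
Qed.

Lemma rtranslateA A s u :
  [set (x * u)%g | x in rtranslate A s] =
  rtranslate A (Some (if s is Some s then (s * u)%g else u)).
Proof.
case: s => [s|//] /=; apply/seteqP; split=> [_ [_ [x Ax <-] <-]|_ [x Ax <-]].
  by exists x => //; rewrite mulgA.
by exists (x * s)%g; [exists x|rewrite mulgA].
Qed.

(** Let X be the finite part of a translate of [F j] whose points x satisfy x^-1 A in [q]. These
    finitely many sets share a point u, so Xu lies in [A], and right cancellation gives |Xu| = |X|: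
    the bound survives in a further translate. *)
Lemma Dstar_umul p q : is_right_cancellative S ->
  Dstar R F p -> UltraFilter q -> Dstar R F (umul p q).
Proof.
move=> cancS [up pD] uq; split; first exact: umul_ultra.
move=> A /pD /density_gt0P [a a0 hC]; apply/density_gt0P; exists a => // j0.
have [j [lej [s hs]]] := hC j0; exists j; split => //.
have [finF _] := F_Pf j.
set X := _ `&` _ in hs.
have finX : finite_set X by apply: finite_setIr; exact: finite_rtranslate.
have : q (\bigcap_(x in [set` fset_set X]) [set t | A (x * t)%g]).
  by apply: filter_bigI => x; rewrite in_fset_set // inE => -[].
move=> /filter_ex [u hu]; exists (Some (if s is Some s then s * u else u)%g).
rewrite -rtranslateA; apply: (le_trans hs); rewrite ler_nat.
rewrite -(@card_image_inj _ _ (fun x => x * u)%g X) //; last first.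
  by move=> x y _ _; exact: cancS.
apply: sub_card.
  by apply: finite_setIr; apply: finite_image; exact: finite_rtranslate.
move=> _ [x Xx <-]; split.
  by apply: hu; rewrite /= in_fset_set // inE.
by exists x => //; case: Xx.
Qed.

End Density.

(** * Boxes in direct products *)

Section SetCoordinate.
Set Implicit Arguments.
Unset Strict Implicit.
Variables (I : Type) (T : I -> Type).

(** [{classic I}] equips [I] with the decidable equality that [dfwith] requires. *)
Definition set_coord (f : forall i, T i) (i : I) (x : T i) : forall i, T i :=
  @dfwith {classic I} T f i x.

Lemma set_coord_eq f i (x : T i) : set_coord f x i = x.
Proof. exact: (@dfwithin {classic I}). Qed.

Lemma set_coord_neq f i (x : T i) k : k <> i -> set_coord f x k = f k.
Proof. by move=> ki; apply: (@dfwithout {classic I}); apply/eqP => /esym. Qed.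

End SetCoordinate.

Section Boxes.
Set Implicit Arguments.
Unset Strict Implicit.
Variables (I : Type) (S : I -> monoidType).
Implicit Types (A : forall i, set (S i)) (x y s : dirprod S).

Definition box A : set (dirprod S) := [set x | forall i, A i (x i)].

(** Freezing coordinate [i] at 1 models the product over the other indices inside the same
    [dirprod S]. *)
Definition box_fiber A i : set (dirprod S) :=
  box (set_coord A [set 1%g] (i:=i)).

Lemma box_fiberP A i y :
  box_fiber A i y <-> y i = 1%g /\ forall k, k <> i -> A k (y k).
Proof.
split=> [Ay|[yi Ay] k].
  split=> [|k ki]; first by have := Ay i; rewrite set_coord_eq.
  by have := Ay k; rewrite set_coord_neq.
have [->|ki] := pselect (k = i); first by rewrite set_coord_eq.
by rewrite set_coord_neq //; exact: Ay.
Qed.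

Lemma box_split A i : box A =
  [set (set_coord z.2 z.1 : dirprod S) | z in A i `*` box_fiber A i].
Proof.
apply/seteqP; split=> [x Ax|_ [[a y] [/= Aa /box_fiberP[yi Ay]] <-] k].
  exists (x i, set_coord x (1%g : S i)).
    split; first exact: Ax.
    apply/box_fiberP; rewrite /= set_coord_eq; split=> // k ki.
    by rewrite set_coord_neq //; exact: Ax.
  apply: functional_extensionality_dep => k /=.
  have [->|ki] := pselect (k = i); first by rewrite set_coord_eq.
  by rewrite !set_coord_neq.
have [->|ki] := pselect (k = i); first by rewrite set_coord_eq.
by rewrite set_coord_neq //; exact: Ay.
Qed.

Lemma card_box A i : finite_set (A i) -> finite_set (box_fiber A i) ->
  card (box A) = (card (A i) * card (box_fiber A i))%N.
Proof.
move=> finA finR; rewrite (box_split A i) card_image_inj ?card_setX //.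
  exact: finite_setX.
move=> [a y] [b z]; rewrite !inE => -[/= _ /box_fiberP[yi _]].
move=> [/= _ /box_fiberP[zi _]] e.
have ab : a = b.
  by have /(congr1 (fun x : dirprod S => x i)) := e; rewrite !set_coord_eq.
suff -> : y = z by rewrite ab.
apply: functional_extensionality_dep => k.
have [->|ki] := pselect (k = i); first by rewrite yi.
have /(congr1 (fun x : dirprod S => x k)) := e.
by rewrite !set_coord_neq.
Qed.

Lemma finite_box A : (forall i, finite_set (A i)) ->
  finite_set [set i | A i <> [set 1%g]] -> finite_set (box A).
Proof.
move=> + /(@finite_seqP {classic I}) [r suppA].
(* An inclusion, unlike an equality, is inherited by the tail of the list once coordinate [i] is
   frozen at 1. *)
have {suppA} : [set i | A i <> [set 1%g]] `<=` [set` r] by rewrite suppA.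
elim: r A => [|i r IH] A suppA finA.
  apply: (@sub_finite_set _ _ [set 1%g]) => //.
  move=> x Ax; apply: functional_extensionality_dep => k.
  have Ak : A k = [set 1%g] by apply: contrapT => /suppA.
  by have := Ax k; rewrite Ak.
rewrite (box_split A i); apply: finite_image; apply: finite_setX => //.
apply: IH => k /=; have [->|ki] := pselect (k = i).
- by rewrite set_coord_eq.
- rewrite set_coord_neq // => /suppA /=.
  by rewrite inE => /orP[/eqP|].
- by rewrite set_coord_eq; exact: finite_set1.
- by rewrite set_coord_neq.
Qed.

Lemma finite_box_fiber A i : (forall i, finite_set (A i)) ->
  finite_set [set i | A i <> [set 1%g]] -> finite_set (box_fiber A i).
Proof.
move=> finA suppA; apply: finite_box => [k|].
  have [->|ki] := pselect (k = i).
    by rewrite set_coord_eq; exact: finite_set1.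
  by rewrite set_coord_neq.
apply: sub_finite_set suppA => k /=.
have [->|ki] := pselect (k = i); first by rewrite set_coord_eq.
by rewrite set_coord_neq.
Qed.

Lemma box_nonempty A : (forall i, A i !=set0) -> box A !=set0.
Proof. by move=> A0; exists (fun i => sval (cid (A0 i))) => i; case: cid. Qed.

Lemma box_fiber_nonempty A i : (forall i, A i !=set0) -> box_fiber A i !=set0.
Proof.
move=> A0; apply: box_nonempty => k; have [->|ki] := pselect (k = i).
  by rewrite set_coord_eq; exists 1%g.
by rewrite set_coord_neq.
Qed.

Lemma box_rtranslate A s : rtranslate (box A) (Some s) =
  box (fun i => rtranslate (A i) (Some (s i))).
Proof.
apply/seteqP; split=> [_ [x Ax <-] i|x Ax]; first by exists (x i).
exists (fun i => s2val (cid2 (Ax i))) => [i|]; first exact: s2valP.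
apply: functional_extensionality_dep => i.
exact: (s2valP' (cid2 (Ax i))).
Qed.

(** The translating element is reset to 1 at [i], where the fiber must keep the value 1. *)
Lemma box_fiber_rtranslate A s i :
  box_fiber (fun i => rtranslate (A i) (Some (s i))) i =
  rtranslate (box_fiber A i) (Some (set_coord s (1%g : S i) : dirprod S)).
Proof.
rewrite box_rtranslate /box_fiber; congr box.
apply: functional_extensionality_dep => k.
have [->|ki] := pselect (k = i); last by rewrite !set_coord_neq.
by rewrite !set_coord_eq /= image_set1 mulg1.
Qed.

Lemma box_cylinder A i (B : set (S i)) :
  (fun x : dirprod S => x i) @^-1` B `&` box A = box (set_coord A (B `&` A i)).
Proof.
apply/seteqP; split=> [x [Bx Ax] k|x Ax].
  have [->|ki] := pselect (k = i); first by rewrite set_coord_eq; split.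
  by rewrite set_coord_neq.
have := Ax i; rewrite set_coord_eq => -[Bx Axi]; split=> // k.
have [->//|ki] := pselect (k = i).
by have := Ax k; rewrite set_coord_neq.
Qed.

(** A translated box is a box, and the cylinder cuts only its factor at [i], so the count splits off
    the fiber. *)
Lemma card_cylinder_rtranslate A s i (B : set (S i)) :
  finite_set (A i) -> finite_set (box_fiber A i) ->
  card ((fun x : dirprod S => x i) @^-1` B `&` rtranslate (box A) (Some s)) =
  (card (B `&` rtranslate (A i) (Some (s i))) *
   card (rtranslate (box_fiber A i)
     (Some (set_coord s (1%g : S i) : dirprod S))))%N.
Proof.
move=> finA finR; rewrite box_rtranslate box_cylinder.
have fib (C : forall k, set (S k)) (X : set (S i)) :
    box_fiber (set_coord C X) i = box_fiber C i.
  congr box; apply: functional_extensionality_dep => k.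
  by have [->|ki] := pselect (k = i); rewrite ?set_coord_eq ?set_coord_neq.
rewrite (@card_box _ i).
- by rewrite fib box_fiber_rtranslate set_coord_eq.
- by rewrite set_coord_eq; apply: finite_setIr; exact: finite_rtranslate.
- by rewrite fib box_fiber_rtranslate; exact: finite_rtranslate.
Qed.

End Boxes.

(** Used to replace the adjoined point [None] by the identity, leaving only translates by genuine
    elements. *)
Lemma rtranslate1 (S : monoidType) (A : set S) :
  rtranslate A (Some 1%g) = A.
Proof.
by rewrite /= -[RHS]image_id; apply: eq_imagel => x _; rewrite mulg1.
Qed.

(** * The product net *)

Section ProductNet.
Set Implicit Arguments.
Unset Strict Implicit.
Local Open Scope ring_scope.
Variables (R : realType) (I : Type) (S : I -> monoidType).
Variables (J : I -> directedSet) (F : forall i, J i -> set (S i)).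
Hypothesis F_Pf : forall i (j : J i), Pf (F j).

Local Notation factors j := (fun i => adjoin_net (@F i) (sval j i)).

Lemma set_index_finite_support (j : prod_index J) i (o : option (J i)) :
  finite_support (set_coord (sval j) o).
Proof.
apply: (@sub_finite_set _ _ ([set k | sval j k <> None] `|` [set i])).
  move=> k /=; have [->|ki] := pselect (k = i); first by right.
  by rewrite set_coord_neq //; left.
by rewrite finite_setU; split; [exact: svalP j|exact: finite_set1].
Qed.

Definition set_index (j : prod_index J) i (o : option (J i)) : prod_index J :=
  exist _ _ (set_index_finite_support j o).

Lemma adjoin_net_Pf i (o : option (J i)) : Pf (adjoin_net (@F i) o).
Proof.
by case: o => [j|] //=; split; [exact: finite_set1|exists 1%g].
Qed.

Lemma adjoin_net_support (j : prod_index J) :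
  finite_set [set i | adjoin_net (@F i) (sval j i) <> [set 1%g]].
Proof.
by apply: sub_finite_set (svalP j) => i /=; case: (sval j i).
Qed.

Lemma prod_net_Pf (j : prod_index J) : Pf (prod_net F j).
Proof.
split.
  apply: (@finite_box _ _ (factors j)) => [i|].
    by case: (adjoin_net_Pf (sval j i)).
  exact: adjoin_net_support.
apply: (@box_nonempty _ _ (factors j)) => i.
by case: (adjoin_net_Pf (sval j i)).
Qed.

Variable i0 : I.
Local Notation pi := (fun x : dirprod S => x i0).

Definition net_fiber (j : prod_index J) : set (dirprod S) :=
  box_fiber (factors j) i0.

Lemma net_fiber_Pf j : Pf (net_fiber j).
Proof.
split.
  apply: finite_box_fiber => [i|]; last exact: adjoin_net_support.
  by case: (adjoin_net_Pf (sval j i)).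
by apply: box_fiber_nonempty => i; case: (adjoin_net_Pf (sval j i)).
Qed.

Lemma card_prod_net j k : sval j i0 = Some k ->
  card (prod_net F j) = (card (F k) * card (net_fiber j))%N.
Proof.
move=> jk; have [finR _] := net_fiber_Pf j.
have [finF _] := adjoin_net_Pf (sval j i0).
by rewrite (@card_box _ _ (factors j) i0 finF finR) /= jk.
Qed.

Lemma card_cylinder_net j k s (B : set (S i0)) : sval j i0 = Some k ->
  card (pi @^-1` B `&` rtranslate (prod_net F j) (Some s)) =
  (card (B `&` rtranslate (F k) (Some (s i0))) *
   card (rtranslate (net_fiber j)
     (Some (set_coord s (1%g : S i0) : dirprod S))))%N.
Proof.
move=> jk; have [finR _] := net_fiber_Pf j.
have [finF _] := adjoin_net_Pf (sval j i0).
by rewrite (@card_cylinder_rtranslate _ _ (factors j) s i0 B finF finR) /= jk.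
Qed.

Let card_fiber_gt0 j : 0 < (card (net_fiber j))%:R :> R.
Proof. by have [? ?] := net_fiber_Pf j; rewrite ltr0n card_fset_set_gt0. Qed.

(** The product sets and their traces on the cylinder both factor into a part at [i0] and a fiber
    part, and the size of the fiber cancels. *)
Lemma cylinder_density (B : set (S i0)) :
  0 < upper_banach_density R (prod_net F) (pi @^-1` B) <->
  0 < upper_banach_density R (@F i0) B.
Proof.
split=> /density_gt0P.
  move=> /(_ prod_net_Pf) [a a0 Ba].
  apply/(density_gt0P _ (@F_Pf i0)); exists a => // k0.
  have [j0] := ds_inhabited (prod_index J).
  (* Starting at [Some k0] forces coordinate [i0] of [j] to be a genuine index above [k0]. *)
  have [j [lej [s hs]]] := Ba (set_index j0 (Some k0)).
  move: (lej i0); rewrite /= set_coord_eq.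
  case jk : (sval j i0) => [k|//] /= lek; exists k; split => //.
  have [s' ss'] : exists s', rtranslate (prod_net F j) s =
      rtranslate (prod_net F j) (Some s').
    by case: s {hs} => [s|]; [exists s|exists 1%g; rewrite rtranslate1].
  exists (Some (s' i0)); move: hs; rewrite ss' (card_prod_net jk).
  rewrite (card_cylinder_net _ _ jk) => hs.
  (* A translate of the fiber has at most as many points as the fiber. *)
  rewrite -(ler_pM2r (card_fiber_gt0 j)) -mulrA -natrM (le_trans hs) //.
  rewrite -natrM ler_nat leq_mul2l; apply/orP; right.
  by apply: card_rtranslate_le; case: (net_fiber_Pf j).
move=> /(_ (@F_Pf i0)) [a a0 Ba].
apply/(density_gt0P _ prod_net_Pf); exists a => // j0.
have [k0 lek0] : exists k0, adjoin_le (sval j0 i0) (Some k0).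
  case: (sval j0 i0) => [k0|]; first by exists k0; exact: ds_le_refl.
  by have [k0] := ds_inhabited (J i0); exists k0.
have [k [lek [s hs]]] := Ba k0.
have jk : sval (set_index j0 (Some k)) i0 = Some k by rewrite /= set_coord_eq.
exists (set_index j0 (Some k)); split.
  move=> i; have [->|ii0] := pselect (i = i0); last first.
    by rewrite /= set_coord_neq //; exact: prod_index_le_refl.
  rewrite jk; case: (sval j0 i0) lek0 => //= k'.
  by move=> /ds_le_trans; apply.
have [s' ss'] : exists s', rtranslate (F k) s = rtranslate (F k) (Some s').
  by case: s {hs} => [s|]; [exists s|exists 1%g; rewrite rtranslate1].
(* Translating only coordinate [i0] leaves the fiber in place, so its size is a common factor of
   both sides. *)
exists (Some (set_coord (1%g : dirprod S) s' : dirprod S)).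
rewrite (card_prod_net jk) (card_cylinder_net _ _ jk) set_coord_eq -ss'.
set t := (X in rtranslate (net_fiber _) (Some X)).
have -> : t = (1%g : dirprod S).
  apply: functional_extensionality_dep => i; rewrite /t.
  by have [->|ii0] := pselect (i = i0); rewrite ?set_coord_eq ?set_coord_neq.
by rewrite rtranslate1 !natrM mulrA ler_wpM2r.
Qed.

End ProductNet.

(** * Lifting idempotents along the projection *)

Section Lifting.
Set Implicit Arguments.
Unset Strict Implicit.
Local Open Scope ring_scope.
Variables (R : realType) (I : Type) (S : I -> monoidType).
Variables (J : I -> directedSet) (F : forall i, J i -> set (S i)).
Hypothesis F_Pf : forall i (j : J i), Pf (F j).
Variable i0 : I.
Local Notation pi := (fun x : dirprod S => x i0).
Local Notation density := (upper_banach_density R (prod_net F)).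

(** Represents the closed set of ultrafilters in [Dstar] that project to [q]. *)
Definition lift_filter (q : set_system (S i0)) : set_system (dirprod S) :=
  [set A | exists2 B, q B & ~ 0 < density ((pi @^-1` B) `\` A)].

(** Taking [B = setT] puts complements of null sets into [p]; taking [A] to be the cylinder over [B]
    fixes the projection. Conversely, if [A] is not in [p], the cylinder minus [A] is in [p] and has
    positive density. *)
Lemma lift_filterP q p : UltraFilter q -> UltraFilter p ->
  lift_filter q `<=` p <-> Dstar R (prod_net F) p /\ fmap pi p = q.
Proof.
move=> uq up; split=> [qp|[[_ pD] pq] A [B qB nA]].
  split.
    split=> // A pA; apply: contrapT => nA.
    apply: (ultra_notC up pA); apply: qp; exists setT; first exact: filterT.
    by rewrite preimage_setT setTD setCK.
  apply: ultra_eq => B qB; apply: qp; exists B => //.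
  by rewrite setDv; exact: density_set0 (prod_net_Pf F_Pf).
rewrite -pq in qB.
case: (in_ultra_setVsetC A up) => // pnA.
by case: nA; apply: pD; exact: filterI.
Qed.

(** Properness is the positive density of cylinders over members of [q]; closure under intersection
    is [density_setU]. *)
Lemma lift_filter_proper q : UltraFilter q -> Dstar R (@F i0) q ->
  ProperFilter (lift_filter q).
Proof.
have P_Pf := prod_net_Pf F_Pf.
move=> uq [_ qD]; split.
  move=> [B qB]; rewrite setD0; apply.
  by apply/(cylinder_density R F_Pf); exact: qD.
split.
- exists setT; first exact: filterT.
  by rewrite setDT; exact: density_set0.
- move=> A A' [B qB nA] [B' qB' nA']; exists (B `&` B'); first exact: filterI.
  move=> h; suff : 0 < density ((pi @^-1` B `\` A) `|` (pi @^-1` B' `\` A')).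
    by move=> /(density_setU P_Pf) [].
  apply: (density_sub P_Pf) h => x [[Bx B'x] /not_andP[nAx|nAx]].
    by left.
  by right.
- move=> A A' AA' [B qB nA]; exists B => // h; apply: nA.
  by apply: (density_sub P_Pf) h; exact: setDS.
Qed.

Lemma idempotent_lift q : (forall i, is_right_cancellative (S i)) ->
  Dstar R (@F i0) q -> umul q q = q ->
  exists p, [/\ Dstar R (prod_net F) p, umul p p = p & fmap pi p = q].
Proof.
move=> cancS qD qq; have [uq _] := qD.
have cancP : is_right_cancellative (dirprod S).
  move=> x y z e.
  apply: functional_extensionality_dep => i; apply: (cancS i _ _ (z i)).
  exact: (congr1 (fun f : dirprod S => f i) e).
have sG : semigroup_filter (lift_filter q).
  split; first exact: lift_filter_proper.
  move=> p r up ur /(lift_filterP uq up) [pD pq] /(lift_filterP uq ur) [rD rq].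
  apply/(lift_filterP uq (umul_ultra up ur)); split.
    exact: (Dstar_umul (prod_net_Pf F_Pf)).
  (* The projection is a homomorphism by computation, so [fmap pi] commutes with [umul]. *)
  by rewrite -qq -{1}pq -rq.
have [p [up Gp pp]] := ellis_numakura sG.
by have [pD pq] := (lift_filterP uq up).1 Gp; exists p.
Qed.

End Lifting.

Theorem corollary5p14 (R : realType) (I : Type) (S : I -> monoidType)
    (J : I -> directedSet) (F : forall i, J i -> set (S i)) (i0 : I)
    (I_infinite : infinite_set [set: I])
    (S_cancel : forall i, is_right_cancellative (S i))
    (F_Pf : forall i (j : J i), Pf (F i j)) :
  [set (fun x : dirprod S => x i0) @` A | A in Dset R (prod_net F)]
    = Dset R (F i0).
Proof.
apply/seteqP; split=> [_ [A [p [[up pD] pp pA]] <-]|B [q [qD qq qB]]].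
  exists (fmap (fun x : dirprod S => x i0) p); split.
  - split; first exact: ultra_fmap.
    by move=> B pB; apply/(cylinder_density R F_Pf); exact: pD.
  - by rewrite -{3}pp.
  - by rewrite /fmap /=; apply: filterS pA => x Ax; exists x.
have [p [pD pp pq]] := idempotent_lift F_Pf S_cancel qD qq.
(* The cylinder over [B] lies in [p] because [p] projects to [q], and it projects onto [B]: a point
   of [B] extends by 1 elsewhere. *)
exists ((fun x : dirprod S => x i0) @^-1` B).
  by exists p; split=> //; rewrite -pq in qB.
apply/seteqP; split=> [_ [x Bx <-]//|x Bx].
by exists (set_coord (1%g : dirprod S) x); rewrite /= set_coord_eq.
Qed.
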